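(* Let $f:\mathbb{R}\to\mathbb{R}$ be a non-negative, not identically zero, compactly supported absolutely continuous function. Then a translate of $f$ can be reconstructed using one test set; that is, there exists a measurable set $T\subset\mathbb{R}$ such that if $b\neq b'$ then $\int_T f(x-b)\,dx\neq\int_T f(x-b')\,dx$. In fact, $T$ can be chosen so that $T$ is a locally finite union of intervals and $\int_T f(x-b)\,dx$ is strictly increasing in $b\in\mathbb{R}$.
   Context: Intervals are bounded and nondegenerate. A union of a family of intervals is locally finite if every bounded interval meets only finitely many members of the family. *)

(* Defs.v *)
From HB Require Import structures.
From mathcomp Require Import all_boot all_order all_algebra.
From mathcomp Require Import all_classical all_reals all_analysis.

Set Implicit Arguments.
Unset Strict Implicit.
Unset Printing Implicit Defensive.

Import Order.TTheory GRing.Theory Num.Theory.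
Import numFieldNormedType.Exports.

Local Open Scope classical_set_scope.
Local Open Scope ring_scope.

(* Epsilon-delta absolute continuity on the whole line.  The open intervals are
   required to be disjoint, so that the closed ones may share endpoints. *)
Definition abs_continuous (R : realType) (f : R -> R) : Prop :=
  forall e : R, 0 < e -> exists2 d : R, 0 < d &
    forall (n : nat) (a b : 'I_n -> R),
      (forall i, a i <= b i) ->
      trivIset [set: 'I_n] (fun i => `]a i, b i[%classic) ->
      \sum_(i < n) (b i - a i) < d ->
      \sum_(i < n) `|f (b i) - f (a i)| < e.

Definition compactly_supported (R : realType) (f : R -> R) : Prop :=
  compact (closure [set x | f x != 0]).

(* Bounded nondegenerate interval; the booleans choose, at each endpoint,
   between the open and the closed version. *)
Definition bounded_interval (R : realType) (J : set R) : Prop :=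
  exists (a b : R) (l r : bool),
    a < b /\ J = [set` Interval (BSide l a) (BSide r b)].

Definition locally_finite (R : realType) (F : set (set R)) : Prop :=
  forall K : set R, bounded_interval K ->
    finite_set [set J | F J /\ J `&` K !=set0].

Definition locally_finite_union_of_intervals (R : realType) (T : set R) : Prop :=
  exists F : set (set R),
    [/\ forall J, F J -> bounded_interval J,
        locally_finite F &
        T = \bigcup_(J in F) J].

(* Main.v *)
Require Import Defs.
From HB Require Import structures.
From mathcomp Require Import all_boot all_order all_algebra.
From mathcomp Require Import all_classical all_reals all_analysis.
From mathcomp Require Import measurable_realfun ring lra zify.

Set Implicit Arguments.
Unset Strict Implicit.
Unset Printing Implicit Defensive.

Import Order.TTheory GRing.Theory Num.Theory.
Import numFieldNormedType.Exports.

Local Open Scope classical_set_scope.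
Local Open Scope ring_scope.

(** The set [T] is a union of short intervals whose density grows.  Cut the line
    into blocks [n w, (n + 1) w), subdivide block [n] into [N n] cells, and let
    [T] contain the initial fraction [phi n] of each cell of block [n], where
    [phi] increases strictly from 0 to 1 along the integers.

    Let [l] and [r] run over the left and right ends of the intervals of [T].
    Since [f] is continuous, the derivative in [b] of the integral over [T] of
    [f (x - b)] is the (locally finite) sum of the [f (l - b) - f (r - b)].  If
    [f] were affine on every cell, then [f (l - b) - f (r - b)] would be [phi n]
    times the drop of [f] on the cell; these drops telescope inside a block, and
    a summation by parts over the blocks turns the derivative into the sum of
    the [(phi n - phi (n - 1)) f (n w - b)].  It is positive as soon as [w] is
    so small that every translate of the grid of blocks hits a place where [f]
    is at least some [c > 0].

    The error made by treating [f] as affine on the cells is [cell_error].  It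
    has to be small uniformly in the translation [b], because [N n] is chosen
    before [b] is known.  The error allowed in block [n] is [phi (n + 1) - phi n]
    times [c] times a lower bound for the increments of [phi] near [n]; as the
    first factors sum to less than 1, the total error stays below any single
    term [c (phi m - phi (m - 1))] with [m] near those blocks ([rate_gt0]).

    Uniform smallness ([small_cell_error]) is where absolute continuity enters:
    [f] can be approximated in variation by piecewise affine functions.  Compare
    the lengths of the polygons inscribed in the graph of [f] over uniform
    grids.  They are bounded; take a grid whose polygon is almost as long as
    their supremum.  Refining it hardly lengthens the polygon, so by strict
    convexity of the Euclidean norm the slopes of a refinement are close, in the
    mean, to the slopes of the coarse polygon ([slope_approximation]).  This
    argument needs bounded slopes; the cells with steep slopes have small total
    length, and absolute continuity makes the variation of [f] over them small.
    Hence [f - q] has small variation for the interpolant [q], and so has small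
    cell error along any grid, while [q] is a finite combination of ramps, each
    of which is affine on all cells but at most one. *)

(** * Uniform grids and absolute continuity *)
Lemma sum_norm_subseq (R : realType) (u : nat -> R) (m : nat -> nat) n K :
  (forall i, (m i <= m i.+1)%N) -> (m n <= K)%N ->
  \sum_(0 <= i < n) `|u (m i.+1) - u (m i)| <=
  \sum_(0 <= k < K) `|u k.+1 - u k|.
Proof.
move=> mono mnK.
apply: (@le_trans _ _ (\sum_(0 <= k < m n) `|u k.+1 - u k|)); last first.
  rewrite [leRHS](big_cat_nat (n := m n))//= lerDl.
  exact: sumr_ge0.
elim: n {mnK} => [|n IH]; first by rewrite big_nil sumr_ge0.
rewrite big_nat_recr//= [leRHS](big_cat_nat (n := m n))//= lerD//.
by rewrite -(telescope_sumr u (mono n)) ler_norm_sum.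
Qed.

Definition grid (R : realType) (a h : R) (k : nat) : R := a + k%:R * h.

Lemma gridS (R : realType) (a h : R) k : grid a h k.+1 = grid a h k + h.
Proof. by rewrite /grid -natr1; ring. Qed.

Lemma le_grid (R : realType) (a h : R) : 0 <= h ->
  {homo grid a h : i j / (i <= j)%N >-> i <= j}.
Proof. by move=> h0 i j ij; rewrite lerD2l ler_wpM2r// ler_nat. Qed.

Lemma grid_refine (R : realType) (a h : R) m i : (0 < m)%N ->
  grid a (h / m%:R) (i * m) = grid a h i.
Proof.
by move=> m0; rewrite /grid natrM mulrA mulrAC mulfK// pnatr_eq0 -lt0n.
Qed.

(** Selecting cells by a predicate is how a family of disjoint intervals is
    presented below; an unselected cell becomes a degenerate interval. *)
Lemma abs_continuous_grid (R : realType) (f : R -> R) (e : R) :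
  abs_continuous f -> 0 < e -> exists2 d : R, 0 < d &
    forall (a h : R) n (S : pred nat), 0 <= h ->
      \sum_(0 <= k < n | S k) h < d ->
      \sum_(0 <= k < n | S k) `|f (grid a h k.+1) - f (grid a h k)| < e.
Proof.
move=> f_ac e0; have [d d0 fd] := f_ac e e0; exists d => // a h n S h0 small.
pose l (i : 'I_n) := grid a h i.
pose r (i : 'I_n) := if S i then grid a h i.+1 else grid a h i.
have lr i : l i <= r i by rewrite /l /r; case: ifP => // _; exact: le_grid.
have := fd n l r lr.
have -> : \sum_(i < n) (r i - l i) = \sum_(0 <= k < n | S k) h.
  rewrite big_mkord [RHS]big_mkcond; apply: eq_bigr => i _.
  rewrite /l /r; case: ifP => _; last by rewrite subrr.
  by rewrite gridS addrC addKr.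
have -> : \sum_(i < n) `|f (r i) - f (l i)| =
    \sum_(0 <= k < n | S k) `|f (grid a h k.+1) - f (grid a h k)|.
  rewrite big_mkord [RHS]big_mkcond; apply: eq_bigr => i _.
  by rewrite /l /r; case: ifP => _ //; rewrite subrr normr0.
apply => //.
have key (i j : 'I_n) x : (i < j)%N -> l i < x < r i -> l j < x < r j -> False.
  move=> ij /andP[_ xi] /andP[xj _].
  have : r i <= l j.
    rewrite /r /l; case: ifP => _; apply: le_grid => //; exact: ltnW.
  by move=> /(lt_le_trans xi) /(lt_trans xj); rewrite ltxx.
move=> i j _ _ [x [/=]]; rewrite !in_itv/= => xi xj.
by case: (ltngtP i j) => ij; [case: (key i j x)|case: (key j i x)|exact/val_inj].
Qed.

(** Refine the grid until [N] consecutive cells are shorter than the modulus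
    [d] for which variations are at most 1; the number [K] of such groups then
    bounds the variation. *)
Lemma grid_variation_bounded (R : realType) (f : R -> R) (a b : R) :
  abs_continuous f -> a <= b -> exists C : R, forall N, (0 < N)%N ->
    \sum_(0 <= k < N) `|f (grid a ((b - a) / N%:R) k.+1) -
                        f (grid a ((b - a) / N%:R) k)| <= C.
Proof.
move=> f_ac ab; have [d d0 fd] := abs_continuous_grid f_ac ltr01.
pose K := (Num.truncn ((b - a) / d)).+1.
have Kd : (b - a) / K%:R < d.
  rewrite ltr_pdivrMr ?ltr0n// mulrC -ltr_pdivrMr//.
  exact: truncnS_gt.
have K0 : (0 < K)%N by []; move: K Kd K0 => K Kd K0.
exists K%:R => N N0.
have N0R : 0 < N%:R :> R by rewrite ltr0n.
have K0R : 0 < K%:R :> R by rewrite ltr0n.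
set h := (b - a) / N%:R.
have h0 : 0 <= h by rewrite /h divr_ge0// subr_ge0.
have kh : 0 <= h / K%:R by rewrite divr_ge0// ltW.
(* Each cell is cut into K parts; the N * K parts form K groups of N. *)
under eq_bigr do rewrite -!(@grid_refine _ a h K)//.
apply: (le_trans (@sum_norm_subseq _ (fun k => f (grid a (h / K%:R) k))
  (fun i => i * K)%N N (N * K) _ _)) => //.
  by move=> i; rewrite leq_mul2r leqnSn orbT.
rewrite mulnC big_nat_mul.
rewrite [leRHS](_ : _ = \sum_(0 <= i < K) 1); last by rewrite sumr_const_nat subn0.
apply: ler_sum_nat => i _; apply/ltW.
rewrite (_ : (i.+1 * N = N + i * N)%N); last by rewrite mulSn.
rewrite -{1}[(i * N)%N]add0n big_addn addnK.
have E k : grid (grid a (h / K%:R) (i * N)) (h / K%:R) k =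
           grid a (h / K%:R) (k + i * N).
  by rewrite /grid natrD; ring.
apply: le_lt_trans (fd (grid a (h / K%:R) (i * N)) (h / K%:R) N xpredT kh _).
  by rewrite le_eqVlt; apply/orP; left; apply/eqP/eq_bigr => k _; rewrite !E addSn.
rewrite sumr_const_nat subn0 -[_ *+ N]mulr_natl.
by rewrite /h (_ : _ * _ = (b - a) / K%:R) //; field; rewrite !gt_eqF.
Qed.

(** * Inscribed polygons and strict convexity *)
Lemma le_of_sqr_le (R : realType) (x y : R) : 0 <= y -> x ^+ 2 <= y ^+ 2 -> x <= y.
Proof.
move=> y0 xy; rewrite leNgt; apply/negP => yx; move: xy.
by rewrite leNgt => /negP; apply; nra.
Qed.

(** Cauchy-Schwarz: the left-hand side is the component of the vector [(h, y)]
    in the direction of slope [s]. *)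
Lemma tangent_le_sqrt (R : realType) (h s y : R) :
  (h + s * y) / Num.sqrt (1 + s ^+ 2) <= Num.sqrt (h ^+ 2 + y ^+ 2).
Proof.
have c0 : 0 < Num.sqrt (1 + s ^+ 2) by rewrite sqrtr_gt0 ltr_pwDl// sqr_ge0.
rewrite ler_pdivrMr//; apply: le_of_sqr_le; first by rewrite mulr_ge0// sqrtr_ge0.
rewrite exprMn !sqr_sqrtr ?addr_ge0 ?sqr_ge0//.
by have := sqr_ge0 (y - s * h); nra.
Qed.

(** Quantitative strict convexity.  Let [e] be the length of [(h, y)], and [l]
    and [t] its components along and across the direction of slope [s], so that
    [t ^ 2 = (e - l) (e + l) <= 2 e (e - l)].  The inequality between the
    arithmetic and geometric means, weighted by [al], then bounds [t] linearly
    in [e] and in the gap [e - l]; linearity allows summation over cells. *)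
Lemma deviation_le_tangent_gap (R : realType) (h s y al M : R) :
  0 < al -> `|s| <= M ->
  `|y - s * h| <= (1 + M) * (al * Num.sqrt (h ^+ 2 + y ^+ 2) +
    (Num.sqrt (h ^+ 2 + y ^+ 2) - (h + s * y) / Num.sqrt (1 + s ^+ 2))
     / (2 * al)).
Proof.
move=> al0 sM.
set e := Num.sqrt (h ^+ 2 + y ^+ 2); set c := Num.sqrt (1 + s ^+ 2).
have e0 : 0 <= e by exact: sqrtr_ge0.
have e2 : e ^+ 2 = h ^+ 2 + y ^+ 2 by rewrite sqr_sqrtr// addr_ge0// sqr_ge0.
have c2 : c ^+ 2 = 1 + s ^+ 2 by rewrite sqr_sqrtr// addr_ge0// sqr_ge0.
have c0 : 0 < c by rewrite sqrtr_gt0 ltr_pwDl// sqr_ge0.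
have M0 : 0 <= M by exact: le_trans sM.
have cM : c <= 1 + M.
  apply: le_of_sqr_le; first by rewrite addr_ge0.
  rewrite c2 -[s ^+ 2]real_normK ?num_real//.
  have : `|s| ^+ 2 <= M ^+ 2 by rewrite ler_pXn2r// nnegrE.
  nra.
set l := (h + s * y) / c; pose t := (y - s * h) / c.
have tc : y - s * h = t * c by rewrite /t divfK// gt_eqF.
have lt2 : l ^+ 2 + t ^+ 2 = e ^+ 2.
  rewrite /l /t !expr_div_n -mulrDl c2 e2.
  have ? : 1 + s ^+ 2 != 0 by rewrite -c2 expf_neq0// gt_eqF.
  by field.
have le : l <= e by exact: tangent_le_sqrt.
have t2 : t ^+ 2 <= 2 * e * (e - l) by rewrite -subr_ge0; nra.
have le0 : 0 <= (e - l) / (2 * al).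
  by rewrite divr_ge0 ?subr_ge0 ?mulr_ge0 ?(ltW al0).
have ta : `|t| <= al * e + (e - l) / (2 * al).
  apply: le_of_sqr_le; first by rewrite addr_ge0// mulr_ge0// ltW.
  rewrite real_normK ?num_real//; apply: (le_trans t2).
  set z := (e - l) / (2 * al).
  have -> : e - l = z * (2 * al) by rewrite divfK// mulf_neq0 ?gt_eqF.
  have : 0 <= (al * e - z) ^+ 2 by exact: sqr_ge0.
  by nra.
rewrite tc normrM (gtr0_norm c0) mulrC.
apply: ler_pM => //; exact: ltW.
Qed.

(** The chord from [n] to [m] has slope [s], so the components of the steps along
    it add up to its length. *)
Lemma sum_tangent (R : realType) (y : nat -> R) (n m : nat) (h : R) :
  (n < m)%N -> 0 < h ->
  let H := (m - n)%:R * h in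
  let s := (y m - y n) / H in
  \sum_(n <= j < m) (h + s * (y j.+1 - y j)) / Num.sqrt (1 + s ^+ 2) =
  Num.sqrt (H ^+ 2 + (y m - y n) ^+ 2).
Proof.
move=> nm h0 H s.
rewrite -mulr_suml big_split/= -mulr_sumr telescope_sumr ?(ltnW nm)//.
rewrite sumr_const_nat -[h *+ _]mulr_natl -/H.
have H0 : 0 < H by rewrite mulr_gt0// ltr0n subn_gt0.
have ys : y m - y n = s * H by rewrite /s divfK// gt_eqF.
have -> : H ^+ 2 + (y m - y n) ^+ 2 = H ^+ 2 * (1 + s ^+ 2) by rewrite ys; ring.
have -> : H + s * (y m - y n) = H * (1 + s ^+ 2) by rewrite ys; ring.
have c0 : 0 < 1 + s ^+ 2 by rewrite ltr_pwDl// sqr_ge0.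
rewrite sqrtrM ?sqr_ge0// sqrtr_sqr gtr0_norm//.
rewrite -{1}(sqr_sqrtr (ltW c0)) expr2 mulrA mulfK//.
by rewrite sqrtr_eq0 -ltNge.
Qed.

Lemma chord_le_arc (R : realType) (y : nat -> R) (n m : nat) (h : R) :
  (n < m)%N -> 0 < h ->
  Num.sqrt (((m - n)%:R * h) ^+ 2 + (y m - y n) ^+ 2) <=
  \sum_(n <= j < m) Num.sqrt (h ^+ 2 + (y j.+1 - y j) ^+ 2).
Proof.
move=> nm h0; rewrite -sum_tangent//; apply: ler_sum_nat => j _.
exact: tangent_le_sqrt.
Qed.

Lemma slope_deviation_le_arc_excess (R : realType) (y : nat -> R) (n m : nat)
    (h al M : R) :
  (n < m)%N -> 0 < h -> 0 < al ->
  let H := (m - n)%:R * h in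
  let s := (y m - y n) / H in
  let L := \sum_(n <= j < m) Num.sqrt (h ^+ 2 + (y j.+1 - y j) ^+ 2) in
  `|s| <= M ->
  \sum_(n <= j < m) `|y j.+1 - y j - s * h| <=
  (1 + M) * (al * L + (L - Num.sqrt (H ^+ 2 + (y m - y n) ^+ 2)) / (2 * al)).
Proof.
move=> nm h0 al0 H s L sM.
apply: le_trans (ler_sum_nat (fun j _ => deviation_le_tangent_gap h (y j.+1 - y j) al0 sM)) _.
rewrite -mulr_sumr big_split/= -mulr_sumr -mulr_suml sumrB.
by rewrite /L /s sum_tangent.
Qed.

Definition arc_length (R : realType) (f : R -> R) (a h : R) (n : nat) : R :=
  \sum_(0 <= k < n)
    Num.sqrt (h ^+ 2 + (f (grid a h k.+1) - f (grid a h k)) ^+ 2).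

Lemma sqrt_sum_sqr_le_add (R : realType) (x y : R) : 0 <= x ->
  Num.sqrt (x ^+ 2 + y ^+ 2) <= x + `|y|.
Proof.
move=> x0; apply: le_of_sqr_le; first by rewrite addr_ge0.
rewrite sqr_sqrtr ?addr_ge0 ?sqr_ge0// -[y ^+ 2]real_normK ?num_real//.
have : 0 <= x * `|y| by rewrite mulr_ge0.
by nra.
Qed.

(** The piecewise affine interpolant of [f] on a suitable grid of [N] cells
    approximates [f] in variation along every refinement of that grid: the
    polygon over [N] cells is chosen within [eta] of the supremum of all
    lengths, so that no refinement is longer by more than [eta]. *)
Lemma slope_approximation (R : realType) (f : R -> R) (a b e : R) :
  abs_continuous f -> a < b -> 0 < e ->
  exists2 N, (0 < N)%N &
    forall m (y := fun k => f (grid a ((b - a) / N%:R / m%:R) k)), (0 < m)%N ->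
    \sum_(0 <= i < N) \sum_(i * m <= j < i.+1 * m)
      `|y j.+1 - y j - (y (i.+1 * m)%N - y (i * m)%N) / m%:R| <= e.
Proof.
move=> f_ac ab e0.
have [C fC] := grid_variation_bounded f_ac (ltW ab).
have C0 : 0 <= C by apply: le_trans (fC 1%N _) => //; exact: sumr_ge0.
have [d d0 fd] := abs_continuous_grid f_ac (divr_gt0 e0 (ltr0Sn _ 3)).
pose M := (C + 1) / d.
have M0 : 0 < M by rewrite divr_gt0// ltr_wpDl.
pose C' := b - a + C.
have C'0 : 0 < C' by rewrite ltr_pwDl// subr_gt0.
(* The weight al and, below, the tolerance eta are such that each of the two
   terms of slope_deviation_le_arc_excess contributes at most e / 4. *)
pose al := e / 4 / ((1 + M) * C').
have M10 : 0 < 1 + M by rewrite addr_gt0.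
have al0 : 0 < al by rewrite divr_gt0 ?mulr_gt0 ?divr_gt0.
pose eta := e * al / (2 * (1 + M)).
have eta0 : 0 < eta by apply: divr_gt0; apply: mulr_gt0.
pose A N := arc_length f a ((b - a) / N%:R) N.
have AC N : (0 < N)%N -> A N <= C'.
  move=> N0; have N0R : 0 < N%:R :> R by rewrite ltr0n.
  have h0 : 0 <= (b - a) / N%:R by rewrite divr_ge0 ?subr_ge0 ?(ltW ab).
  apply: (@le_trans _ _ (\sum_(0 <= k < N) ((b - a) / N%:R +
    `|f (grid a ((b - a) / N%:R) k.+1) - f (grid a ((b - a) / N%:R) k)|))).
    by apply: ler_sum_nat => k _; exact: sqrt_sum_sqr_le_add.
  rewrite big_split/= sumr_const_nat subn0 -[_ *+ N]mulr_natl mulrC divfK ?gt_eqF//.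
  by rewrite lerD2l fC.
pose E := [set A N.+1 | N in [set: nat]].
have supE : has_sup E.
  split; first by exists (A 1%N), 0%N.
  by exists C' => _ [N _ <-]; exact: AC.
have [_ [N' _ <-] NE] := sup_adherent eta0 supE.
set N := N'.+1 in NE; have N0 : (0 < N)%N by [].
exists N => //; move: N N0 NE => N N0 NE m y m0.
have N0R : 0 < N%:R :> R by rewrite ltr0n.
have m0R : 0 < m%:R :> R by rewrite ltr0n.
have Nm0 : (0 < N * m)%N by rewrite muln_gt0 N0.
set h := (b - a) / N%:R; set h' := h / m%:R.
have h'E : h' = (b - a) / (N * m)%:R by rewrite natrM /h' /h invfM mulrA.
have h0 : 0 < h by rewrite divr_gt0// subr_gt0.
have h'0 : 0 < h' by rewrite divr_gt0.
have hm : m%:R * h' = h by rewrite /h' mulrC divfK// gt_eqF.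
have yE i : y (i * m)%N = f (grid a h i) by rewrite /y grid_refine.
pose v k := `|y k.+1 - y k|.
pose L i := \sum_(i * m <= j < i.+1 * m) Num.sqrt (h' ^+ 2 + (y j.+1 - y j) ^+ 2).
pose G i := Num.sqrt (h ^+ 2 + (y (i.+1 * m)%N - y (i * m)%N) ^+ 2).
pose s i := (y (i.+1 * m)%N - y (i * m)%N) / h.
have mi i : (i * m < i.+1 * m)%N by rewrite ltn_mul2r m0 ltnSn.
have mB i : (i.+1 * m - i * m = m)%N by rewrite mulSn addnK.
have GL i : G i <= L i by have := chord_le_arc y (mi i) h'0; rewrite mB hm.
have sh i : s i * h' = (y (i.+1 * m)%N - y (i * m)%N) / m%:R.
  by rewrite /s /h'; field; rewrite ?gt_eqF.
have sumL : \sum_(0 <= i < N) L i = A (N * m)%N.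
  by rewrite /A /arc_length -h'E big_nat_mul.
have sumG : \sum_(0 <= i < N) G i = A N.
  by apply: eq_bigr => i _; rewrite /G !yE.
have excess : A (N * m)%N - A N <= eta.
  have : A (N * m)%N <= sup E.
    by apply: sup_ubound; [case: supE|exists (N * m).-1 => //; rewrite prednK].
  by move: NE; lra.
(* The slope s i is steep when it exceeds M; the total length of the steep
   cells is at most C / M < d. *)
pose S k := M < `|s (k %/ m)%N|.
have SE i j : (i * m <= j < i.+1 * m)%N -> (j %/ m)%N = i.
  move=> /andP[ij ji]; apply/eqP; rewrite eqn_leq -ltnS ltn_divLR// ji.
  by rewrite leq_divRL// ij.
have steep : \sum_(0 <= k < N * m | S k) v k < e / 4.
  apply: fd; first exact: ltW.
  have -> : \sum_(0 <= k < N * m | S k) h' = \sum_(0 <= i < N | M < `|s i|) h.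
    rewrite big_mkcond big_nat_mul [RHS]big_mkcond; apply: eq_bigr => i _.
    rewrite (eq_big_nat _ _ (F2 := fun=> if M < `|s i| then h' else 0)).
      rewrite sumr_const_nat mB; case: ifP => _; last by rewrite mul0rn.
      by rewrite -[h' *+ m]mulr_natl hm.
    by move=> j ij; rewrite /S (SE i j ij).
  have : M * \sum_(0 <= i < N | M < `|s i|) h <= C.
    apply: le_trans (fC N N0); rewrite mulr_sumr big_mkcond/=.
    apply: ler_sum_nat => i _; case: ifP => // Ms.
    rewrite -/h -!yE -[X in _ <= `|X|](divfK (lt0r_neq0 h0)).
    rewrite normrM (gtr0_norm h0); apply: ler_wpM2r; first exact: ltW.
    exact: ltW.
  rewrite mulrC -ler_pdivlMr// => /le_lt_trans; apply.
  by rewrite /M invf_div mulrA ltr_pdivrMr ?ltr_wpDl//; nra.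
(* Convexity controls the cells that are not steep; on a steep cell both f and
   its chord vary by at most the variation of f over the subcells. *)
pose B i := (1 + M) * (al * L i + (L i - G i) / (2 * al)).
have cell i : \sum_(i * m <= j < i.+1 * m) `|y j.+1 - y j - s i * h'| <=
    B i + 2 * \sum_(i * m <= j < i.+1 * m | S j) v j.
  have [sM|sM] := leP `|s i| M.
    rewrite -[leLHS]addr0 lerD//; last first.
      by apply: mulr_ge0 => //; apply: sumr_ge0 => j _; exact: normr_ge0.
    have := @slope_deviation_le_arc_excess _ y _ _ h' al M (mi i) h'0 al0.
    by rewrite mB hm; apply.
  have L0 : 0 <= L i by apply: sumr_ge0 => *; exact: sqrtr_ge0.
  rewrite -[leLHS]add0r lerD//.
    apply: mulr_ge0; first exact: ltW.
    apply: addr_ge0; first by rewrite mulr_ge0// ltW.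
    by apply: divr_ge0; [rewrite subr_ge0|rewrite mulr_ge0// ltW].
  rewrite [X in 2 * X](_ : _ = \sum_(i * m <= j < i.+1 * m) v j); last first.
    rewrite [LHS]big_mkcond; apply: eq_big_nat => j /SE ji.
    by rewrite /S ji sM.
  apply: (@le_trans _ _ (\sum_(i * m <= j < i.+1 * m) (v j + `|s i * h'|))).
    by apply: ler_sum_nat => j _; exact: ler_normB.
  rewrite big_split/= mulr2n mulrDl mul1r lerD2l sumr_const_nat mB.
  rewrite sh normrM normfV [`|m%:R|]gtr0_norm// -[_ *+ m]mulr_natl mulrC divfK ?gt_eqF//.
  rewrite -telescope_sumr ?(ltnW (mi i))//.
  exact: ler_norm_sum.
rewrite (eq_bigr (fun i => \sum_(i * m <= j < i.+1 * m) `|y j.+1 - y j - s i * h'|)); last first.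
  by move=> i _; apply: eq_bigr => j _; rewrite sh.
apply: le_trans (ler_sum_nat (fun i _ => cell i)) _.
rewrite big_split/= -[X in _ + X]mulr_sumr.
have -> : \sum_(0 <= i < N) \sum_(i * m <= j < i.+1 * m | S j) v j =
          \sum_(0 <= k < N * m | S k) v k.
  rewrite [RHS]big_mkcond big_nat_mul; apply: eq_bigr => i _.
  by rewrite [LHS]big_mkcond.
rewrite /B -mulr_sumr big_split/= -mulr_sumr -mulr_suml sumrB sumL sumG.
have b1 : (1 + M) * (al * A (N * m)%N) <= e / 4.
  rewrite mulrA -ler_pdivlMl; last exact: mulr_gt0.
  rewrite (_ : _ * (e / 4) = C') ?AC//.
  by rewrite /al; field; rewrite !gt_eqF.
have b2 : (1 + M) * ((A (N * m)%N - A N) / (2 * al)) <= e / 4.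
  rewrite mulrA ler_pdivrMr; last exact: mulr_gt0.
  rewrite -ler_pdivlMl//.
  apply: le_trans excess _; rewrite /eta le_eqVlt; apply/orP; left; apply/eqP.
  by field; rewrite gt_eqF.
by rewrite mulrDr; move: steep b1 b2; lra.
Qed.

(** * Approximation in variation by hinge sums *)
Lemma abs_continuous_uniformly (R : realType) (f : R -> R) (e : R) :
  abs_continuous f -> 0 < e ->
  exists2 d : R, 0 < d & forall x y, `|x - y| < d -> `|f x - f y| < e.
Proof.
move=> f_ac e0; have [d d0 fd] := abs_continuous_grid f_ac e0.
exists d => // x y; wlog xy : x y / y <= x.
  by move=> H; have [/H//|/ltW/H] := leP y x; rewrite distrC [X in _ -> X < _]distrC.
rewrite ger0_norm ?subr_ge0// => xyd.
have := fd y (x - y) 1%N xpredT; rewrite !big_nat1 gridS /grid mul0r addr0 subrKC.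
by apply => //; rewrite subr_ge0.
Qed.

Definition ramp (R : realType) (a x : R) : R := Num.max (x - a) 0.

Lemma ramp_ge (R : realType) (a x : R) : a <= x -> ramp a x = x - a.
Proof. by move=> ax; rewrite /ramp max_l// subr_ge0. Qed.

Lemma ramp_le (R : realType) (a x : R) : x <= a -> ramp a x = 0.
Proof. by move=> ax; rewrite /ramp max_r// subr_le0. Qed.

Lemma ramp_lipschitz (R : realType) (a x y : R) :
  `|ramp a x - ramp a y| <= `|x - y|.
Proof.
wlog xy : x y / x <= y.
  move=> H; have [|yx] := leP x y; first exact: H.
  by rewrite distrC [leRHS]distrC; apply/H/ltW.
rewrite distrC [leRHS]distrC [leRHS]ger0_norm ?subr_ge0//.
have [xa|/ltW ax] := leP x a.
  rewrite (ramp_le xa) subr0; have [ya|/ltW ay] := leP y a.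
    by rewrite (ramp_le ya) normr0 subr_ge0.
  by rewrite (ramp_ge ay) ger0_norm ?subr_ge0// lerD2l lerN2.
rewrite (ramp_ge ax) (ramp_ge (le_trans ax xy)) ger0_norm; first by lra.
by lra.
Qed.

(** For increasing nodes [t], the continuous function that vanishes to the left
    of [t 0], has slope [s i] between [t i] and [t i.+1], and is constant to the
    right of [t N]. *)
Definition hinge_sum (R : realType) (s t : nat -> R) (N : nat) (x : R) : R :=
  \sum_(0 <= i < N) s i * (ramp (t i) x - ramp (t i.+1) x).

Lemma hinge_sum_uniformly_continuous (R : realType) (s t : nat -> R) N (e : R) :
  0 < e -> exists2 d : R, 0 < d & forall x y, `|x - y| < d ->
    `|hinge_sum s t N x - hinge_sum s t N y| < e.
Proof.
move=> e0; pose S := \sum_(0 <= i < N) `|s i|.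
have S0 : 0 <= S by exact: sumr_ge0.
exists (e / (2 * S + 1)) => [|x y xy]; first by rewrite divr_gt0// ltr_wpDl// mulr_ge0.
apply: (@le_lt_trans _ _ (2 * S * `|x - y|)); last first.
  move: xy; rewrite ltr_pdivlMr ?ltr_wpDl ?mulr_ge0//.
  by have := normr_ge0 (x - y); nra.
rewrite /hinge_sum -sumrB; apply: le_trans (ler_norm_sum _ _ _) _.
rewrite [2 * S]mulrC /S -mulrA mulr_suml; apply: ler_sum_nat => i _.
rewrite -mulrBr normrM; apply: ler_wpM2l => //.
set A := ramp _ x; set B := ramp _ x; set C := ramp _ y; set D := ramp _ y.
have -> : A - B - (C - D) = (A - C) - (B - D) by ring.
apply: le_trans (ler_normB _ _) _.
by rewrite mulr2n mulrDl mul1r lerD// ramp_lipschitz.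
Qed.

Section Interpolant.
Variables (R : realType) (s : nat -> R) (a h : R) (N : nat).
Hypothesis h0 : 0 <= h.
Let q := hinge_sum s (grid a h) N.

Lemma hinge_sum_left x : x <= a -> q x = 0.
Proof.
move=> xa; rewrite /q /hinge_sum big1// => i _.
have le i' : x <= grid a h i' by rewrite (le_trans xa)// lerDl mulr_ge0.
by rewrite !ramp_le// subrr mulr0.
Qed.

Lemma hinge_sum_right x : grid a h N <= x -> q x = \sum_(0 <= i < N) s i * h.
Proof.
move=> Nx; apply: eq_big_nat => i /andP[_ iN].
rewrite !ramp_ge ?gridS; first by congr (_ * _); ring.
  by rewrite -gridS; apply: le_trans Nx; exact: le_grid.
by apply: le_trans Nx; apply: le_grid => //; exact: ltnW.
Qed.

Lemma hinge_sum_cell i x y : (i < N)%N ->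
  grid a h i <= x <= grid a h i.+1 -> grid a h i <= y <= grid a h i.+1 ->
  q y - q x = s i * (y - x).
Proof.
move=> iN /andP[ix xi] /andP[iy yi].
rewrite /q /hinge_sum -sumrB big_mkord (bigD1 (Ordinal iN))//=.
rewrite (ramp_ge ix) (ramp_ge iy) (ramp_le xi) (ramp_le yi) big1 ?addr0; first by ring.
move=> k ki; have [ki'|ik|ki'] := ltngtP k i; last first.
- by move: ki; rewrite -val_eqE/= ki' eqxx.
- rewrite !ramp_le ?subrr//; apply: le_trans xi _ || apply: le_trans yi _;
    apply: le_grid => //; exact: leqW.
- rewrite !ramp_ge ?gridS -?mulrBr; first by rewrite (_ : _ - _ = 0) ?mulr0//; ring.
  all: rewrite -?gridS; apply: le_trans ix || apply: le_trans iy; apply: le_grid => //.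
  all: exact: ltnW.
Qed.

End Interpolant.

(** An upper bound on the total variation of [g] over the whole line. *)
Definition variation_le (R : realType) (g : R -> R) (e : R) :=
  forall n (y : nat -> R), (forall i, y i <= y i.+1) ->
    \sum_(0 <= i < n) `|g (y i.+1) - g (y i)| <= e.

(** A finite sequence of points can be moved to nearby points of a sufficiently
    fine grid, at an arbitrarily small cost by uniform continuity; there the
    triangle inequality applies. *)
Lemma variation_le_of_grids (R : realType) (g : R -> R) (a b e : R) N :
  a < b -> (0 < N)%N ->
  (forall x, x <= a -> g x = 0) -> (forall x, b <= x -> g x = 0) ->
  (forall e, 0 < e -> exists2 d : R, 0 < d & forall x y, `|x - y| < d ->
     `|g x - g y| < e) ->
  (forall m (x := grid a ((b - a) / N%:R / m%:R)), (0 < m)%N ->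
     \sum_(0 <= k < N * m) `|g (x k.+1) - g (x k)| <= e) ->
  variation_le g e.
Proof.
move=> ab N0 ga gb gc gN n y ymono; apply/ler_addgt0Pr => eta eta0.
have eta'0 : 0 < eta / (2 * n.+1%:R) by rewrite divr_gt0// mulr_gt0.
have [d d0 gd] := gc _ eta'0.
pose m := (Num.truncn ((b - a) / d)).+1.
have md : (b - a) / m%:R < d.
  by rewrite ltr_pdivrMr ?ltr0n// mulrC -ltr_pdivrMr//; exact: truncnS_gt.
have m0 : (0 < m)%N by [].
move: m md m0 => m md m0.
have m0R : 0 < m%:R :> R by rewrite ltr0n.
have N0R : 0 < N%:R :> R by rewrite ltr0n.
pose h := (b - a) / N%:R / m%:R.
have h0 : 0 < h by rewrite !divr_gt0// subr_gt0.
have hd : h < d.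
  apply: le_lt_trans md; rewrite ler_wpM2r ?invr_ge0 ?(ltW m0R)//.
  by rewrite ler_pdivrMr// ler_peMr ?subr_ge0 ?(ltW ab)// ler1n.
(* Points outside [a, b] can be moved to its ends, where g vanishes too. *)
pose z i := Num.min (Num.max (y i) a) b.
have gz i : g (z i) = g (y i).
  rewrite /z; have [ya|ay] := leP (y i) a; first by rewrite min_l ?(ltW ab)// !ga.
  by have [//|yb] := leP (y i) b; rewrite !gb// ltW.
have az i : a <= z i by rewrite /z le_min le_max lexx orbT ltW.
have zb i : z i <= b by rewrite /z ge_min lexx orbT.
have zmono i : z i <= z i.+1.
  by rewrite /z le_min2// le_max2.
pose k i := Num.truncn ((z i - a) / h).
have zh i : 0 <= (z i - a) / h by rewrite divr_ge0 ?subr_ge0// ltW.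
have kmono i : (k i <= k i.+1)%N.
  by apply: le_truncn; rewrite ler_wpM2r ?invr_ge0 ?(ltW h0)// lerB.
have kN i : (k i <= N * m)%N.
  rewrite truncn_le_nat ltr_pdivrMr// -natr1 mulrDl mul1r.
  have -> : (N * m)%:R * h = b - a by rewrite natrM /h; field; rewrite !gt_eqF.
  by move: (zb i); lra.
have kz i : `|g (grid a h (k i)) - g (z i)| < eta / (2 * n.+1%:R).
  apply: gd; apply: le_lt_trans hd; rewrite distrC /grid.
  have /andP[] := truncn_itv (zh i); rewrite -/(k i) ler_pdivlMr// ltr_pdivrMr//.
  rewrite -natr1 mulrDl mul1r => kz1 kz2; rewrite ger0_norm; lra.
apply: (@le_trans _ _ (\sum_(0 <= i < n) (`|g (grid a h (k i.+1)) - g (grid a h (k i))|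
   + eta / n.+1%:R))).
  apply: ler_sum_nat => i _; rewrite -!gz.
  have -> : eta / n.+1%:R = eta / (2 * n.+1%:R) + eta / (2 * n.+1%:R).
    by move: (ltr0Sn R n); move: n.+1%:R => c c0; field; rewrite gt_eqF.
  set u := g (grid a h (k i)); set v := g (grid a h (k i.+1)).
  have -> : g (z i.+1) - g (z i) = (v - u) + ((u - g (z i)) - (v - g (z i.+1))).
    by ring.
  apply: le_trans (ler_normD _ _) _; rewrite lerD2l.
  by apply: le_trans (ler_normB _ _) _; rewrite lerD// ltW// kz.
rewrite big_split/= lerD//.
  apply: le_trans (gN m m0).
  exact: (@sum_norm_subseq _ (fun k => g (grid a h k)) k n (N * m)).
rewrite sumr_const_nat subn0 -[_ *+ n]mulr_natl mulrA ler_pdivrMr ?ltr0n//.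
by rewrite mulrC ler_pM2l// ler_nat.
Qed.

(** The failure of [g] to be affine on the cells of a grid, tested at the point
    that cuts each cell in the proportion [phi] to [1 - phi]. *)
Definition cell_error (R : realType) (g : R -> R) (p h phi : R) (N : nat) : R :=
  \sum_(0 <= k < N)
    `|g (grid p h k + phi * h) - g (grid p h k)
      - phi * (g (grid p h k.+1) - g (grid p h k))|.

(** On a cell with successive increments [u] and [v], the error is
    [`|(1 - phi) u - phi v|], which is at most [`|u| + `|v|]. *)
Lemma cell_error_le_variation (R : realType) (g : R -> R) (e p h phi : R) N :
  variation_le g e -> 0 <= h -> 0 <= phi <= 1 -> cell_error g p h phi N <= e.
Proof.
move=> ge h0 /andP[phi0 phi1].
(* The grid points and the cutting points, listed in increasing order. *)
pose y j := grid p h j./2 + (odd j)%:R * (phi * h).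
have ymono j : y j <= y j.+1.
  rewrite /y /= uphalf_half; case: (odd j) => /=.
    rewrite mul1r mul0r addr0 add1n gridS lerD2l.
    by rewrite ler_piMl.
  by rewrite mul0r addr0 mul1r add0n lerDl mulr_ge0.
apply: le_trans (ge N.*2 y ymono).
rewrite /cell_error; elim: N => [|N IH]; first by rewrite !big_nil.
rewrite doubleS big_nat_recr//= !big_nat_recr//= -addrA lerD//.
have -> : y N.*2 = grid p h N by rewrite /y doubleK odd_double mul0r addr0.
have -> : y N.*2.+1 = grid p h N + phi * h.
  by rewrite /y /= uphalf_double odd_double mul1r.
have -> : y N.*2.+2 = grid p h N.+1.
  by rewrite /y /= negbK doubleK odd_double mul0r addr0.
set u := g _; set v := g _; set w := g _.
have -> : u - v - phi * (w - v) = (1 - phi) * (u - v) - phi * (w - u) by ring.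
apply: le_trans (ler_normB _ _) _; rewrite !normrM.
rewrite (ger0_norm phi0) ger0_norm ?subr_ge0//.
have := normr_ge0 (u - v); have := normr_ge0 (w - u); nra.
Qed.

(** Only the cell that contains the corner [a] contributes, and it contributes at
    most [h]; to single it out, each term is bounded by [h] times the jump
    across the cell of the indicator [H] of [a <= x], and the jumps telescope. *)
Lemma cell_error_ramp (R : realType) (a p h phi : R) N :
  0 <= h -> 0 <= phi <= 1 -> cell_error (ramp a) p h phi N <= h.
Proof.
move=> h0 /andP[phi0 phi1].
pose H k : R := (a <= grid p h k)%R%:R.
apply: (@le_trans _ _ (\sum_(0 <= k < N) h * (H k.+1 - H k))); last first.
  rewrite -mulr_sumr telescope_sumr// ler_piMr// /H.
  by case: (a <= _); case: (a <= _); rewrite ?subrr ?subr0 ?sub0r ?ler01// oppr_le0 ltW// .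
apply: ler_sum_nat => k _; rewrite /H gridS.
set x := grid p h k.
have xphi : x <= x + phi * h by rewrite lerDl mulr_ge0.
have phih : phi * h <= h by rewrite ler_piMl.
have [ax|xa] := leP a x.
  have -> : a <= x + h by rewrite (le_trans ax)// lerDl.
  rewrite !ramp_ge ?(le_trans ax)// ?lerDl//.
  by rewrite (_ : _ - _ = 0) ?normr0 ?subrr ?mulr0//; ring.
have [ah|ha] := leP a (x + h); last first.
  have a1 : x + phi * h <= a by apply: le_trans (ltW ha); rewrite lerD2l.
  by rewrite (ramp_le (ltW ha)) (ramp_le (ltW xa)) (ramp_le a1) !subrr !mulr0 subrr normr0.
rewrite subr0 mulr1 (ramp_le (ltW xa)) !subr0 (ramp_ge ah).
have [a1|/ltW a1] := leP a (x + phi * h).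
  by rewrite (ramp_ge a1) ler_norml; apply/andP; split; nra.
by rewrite (ramp_le a1) ler_norml; apply/andP; split; nra.
Qed.

Lemma cell_error_hinge_sum (R : realType) (s t : nat -> R) n (p h phi : R) N :
  0 <= h -> 0 <= phi <= 1 ->
  cell_error (hinge_sum s t n) p h phi N <= \sum_(0 <= i < n) `|s i| * (2 * h).
Proof.
move=> h0 phi01.
have E i : `|s i| * (cell_error (ramp (t i)) p h phi N +
                     cell_error (ramp (t i.+1)) p h phi N) <= `|s i| * (2 * h).
  rewrite ler_wpM2l// mulr2n mulrDl mul1r lerD//; exact: cell_error_ramp.
apply: le_trans (ler_sum_nat (fun i _ => E i)).
rewrite /cell_error.
under [leRHS]eq_bigr do rewrite -big_split/= mulr_sumr.
rewrite exchange_big/=; apply: ler_sum_nat => k _.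
rewrite /hinge_sum -!sumrB mulr_sumr -sumrB.
apply: le_trans (ler_norm_sum _ _ _) _; apply: ler_sum_nat => i _.
set X := _ - phi * (ramp (t i) _ - _); set Y := _ - phi * (ramp (t i.+1) _ - _).
rewrite [X in `|X|](_ : _ = s i * (X - Y)); last by rewrite /X /Y; ring.
by rewrite normrM ler_wpM2l// ler_normB.
Qed.

(** The bound is uniform in the position [p] of the grid because it splits into
    the variation of [f - q], which ignores the grid, and the error of the hinge
    sum [q], which is at most a constant times the mesh. *)
Lemma small_cell_error (R : realType) (f : R -> R) (a b w e : R) :
  abs_continuous f -> a < b ->
  (forall x, x <= a -> f x = 0) -> (forall x, b <= x -> f x = 0) ->
  0 < w -> 0 < e ->
  exists N, (0 < N)%N /\ forall p phi, 0 <= phi <= 1 ->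
    cell_error f p (w / N%:R) phi N <= e.
Proof.
move=> f_ac ab fa fb w0 e0.
have e20 : 0 < e / 2 by rewrite divr_gt0.
have [n n0 fn] := slope_approximation f_ac ab e20.
have n0R : 0 < n%:R :> R by rewrite ltr0n.
pose h := (b - a) / n%:R.
have h0 : 0 < h by rewrite divr_gt0// subr_gt0.
pose s i := (f (grid a h i.+1) - f (grid a h i)) / h.
pose q := hinge_sum s (grid a h) n.
have gridn : grid a h n = b by rewrite /grid /h mulrC divfK ?gt_eqF// subrKC.
have gvar : variation_le (fun x => f x - q x) (e / 2).
  apply: (@variation_le_of_grids _ _ a b _ n) => //.
  - by move=> x xa; rewrite fa// /q (hinge_sum_left _ _ (ltW h0))// subrr.
  - move=> x bx; rewrite fb// /q (hinge_sum_right _ (ltW h0)) ?gridn//.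
    under eq_bigr do rewrite divfK ?gt_eqF//.
    by rewrite telescope_sumr// gridn fb// fa ?subrr// /grid mul0r addr0.
  - move=> eta eta0; have eta20 : 0 < eta / 2 by rewrite divr_gt0.
    have [d1 d10 qd] := hinge_sum_uniformly_continuous s (grid a h) n eta20.
    have [d2 d20 fd] := abs_continuous_uniformly f_ac eta20.
    exists (Num.min d1 d2) => [|x y]; first by rewrite lt_min d10.
    rewrite lt_min => /andP[xy1 xy2].
    have -> : f x - q x - (f y - q y) = f x - f y - (q x - q y) by ring.
    apply: le_lt_trans (ler_normB _ _) _.
    by have := qd _ _ xy1; rewrite -/q; have := fd _ _ xy2; lra.
  - move=> m x m0; apply: le_trans (fn m m0).
    have m0R : 0 < m%:R :> R by rewrite ltr0n.
    rewrite big_nat_mul le_eqVlt; apply/orP; left; apply/eqP.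
    apply: eq_big_nat => i /andP[_ iN]; apply: eq_big_nat => j /andP[ij ji].
    have gi k : grid a h k = x (k * m)%N by rewrite /x grid_refine.
    have xm : {homo x : i j / (i <= j)%N >-> i <= j}.
      by apply: le_grid; rewrite !divr_ge0// subr_ge0 ltW.
    congr `|_|; rewrite -/h -/x.
    have -> : f (x j.+1) - q (x j.+1) - (f (x j) - q (x j)) =
              f (x j.+1) - f (x j) - (q (x j.+1) - q (x j)) by ring.
    congr (_ - _); rewrite /q (hinge_sum_cell s (ltW h0) iN) ?gi.
    + rewrite /x gridS addrAC subrr add0r /s !gi.
      by rewrite -/h; field; rewrite !gt_eqF.
    + by rewrite !xm// ltnW.
    + by rewrite !xm// (leq_trans ij).
pose S := \sum_(0 <= i < n) `|s i|.
have S0 : 0 <= S by exact: sumr_ge0.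
pose N := (Num.truncn (4 * S * w / e)).+1.
exists N; split => // p phi phi01.
have N0R : 0 < N%:R :> R by rewrite ltr0n.
have w'0 : 0 <= w / N%:R by rewrite divr_ge0 ?(ltW w0)// ltW.
have : cell_error f p (w / N%:R) phi N <=
   cell_error (fun x => f x - q x) p (w / N%:R) phi N +
   cell_error q p (w / N%:R) phi N.
  rewrite /cell_error -big_split/=; apply: ler_sum_nat => k _.
  apply: le_trans _ (ler_normD _ _); rewrite le_eqVlt; apply/orP; left; apply/eqP.
  by congr `|_|; ring.
move=> /le_trans; apply; rewrite (splitr e); apply: lerD.
  exact: cell_error_le_variation.
apply: le_trans (cell_error_hinge_sum _ _ _ _ _ w'0 phi01) _.
rewrite -mulr_suml -/S.
have : 4 * S * w / e < N%:R by exact: truncnS_gt.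
rewrite ltr_pdivrMr// => ?.
rewrite mulrA mulrA ler_pdivrMr//; lra.
Qed.

(** * Integrals of translates *)
Lemma compactly_supported_bounded (R : realType) (f : R -> R) :
  compactly_supported f ->
  exists2 A : R, 0 < A & forall x, A <= `|x| -> f x = 0.
Proof.
move=> /compact_bounded [M [_ Mf]]; exists (`|M| + 2) => [|x Ax].
  by rewrite ltr_wpDl.
apply/eqP/negPn/negP => fx0.
have : `|x| <= `|M| + 1.
  by apply: Mf; [rewrite (le_lt_trans (ler_norm _))// ltrDl|exact: subset_closure].
by move: Ax; lra.
Qed.

Lemma abs_continuous_continuous (R : realType) (f : R -> R) :
  abs_continuous f -> continuous f.
Proof.
move=> f_ac x; apply/cvgrPdist_lt => e e0.
have [d d0 fd] := abs_continuous_uniformly f_ac e0.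
near=> y; apply: fd.
by near: y; apply: cvgr_dist_lt.
Unshelve. all: by end_near. Qed.

Lemma primitive_exists (R : realType) (f : R -> R) (A : R) :
  continuous f -> 0 < A -> (forall x, A <= `|x| -> f x = 0) ->
  exists P : R -> R, forall x : R, is_derive x 1 P (f x).
Proof.
move=> fc A0 fA.
have fT : lebesgue_measure.-integrable [set: R] (EFin \o f).
  rewrite (_ : EFin \o f = (EFin \o f) \_ `[- A, A]); last first.
    apply/funext => x; rewrite patchE; case: ifPn => // /negP xA /=.
    rewrite fA// leNgt; apply/negP => /ltW; rewrite ler_norml => xA'.
    by apply: xA; rewrite inE/= in_itv.
  apply: (integrable_mkcond (mu := lebesgue_measure) (EFin \o f)
    (measurable_itv `[- A, A]%R)).1.
  apply: continuous_compact_integrable; first exact: segment_compact.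
  exact: continuous_subspaceT.
exists (fun x => \int[lebesgue_measure]_(t in `]-oo, x]) f t) => x.
have [] := @continuous_FTC1 R f -oo%O x (x + 1) _ _ _ (fc x).
- by rewrite ltrDl.
- by apply: integrableS fT.
- by rewrite ltNyr.
- by move=> df <-; rewrite derive1E; exact/derivableP.
Qed.

Lemma integral_translate (R : realType) (f P : R -> R) (l r b : R) :
  continuous f -> (forall x : R, is_derive x 1 P (f x)) -> l < r ->
  (\int[lebesgue_measure]_(x in `[l, r]) (f (x - b))%:E =
   (P (r - b) - P (l - b))%:E)%E.
Proof.
move=> fc dP lr.
have dPb (x : R) : is_derive x 1 (fun y => P (y - b)) (f (x - b)).
  rewrite -[X in is_derive _ _ _ X]mulr1; apply: (@is_derive1_comp _ P (fun y => y - b)).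
  by apply: is_derive_eq; rewrite subr0.
have cPb : continuous (fun y => P (y - b)).
  by move=> x; apply/differentiable_continuous/derivable1_diffP; case: (dPb x).
rewrite (@continuous_FTC2 _ (fun x => f (x - b)) (fun x => P (x - b)))//.
- apply: continuous_subspaceT => x; apply: continuous_comp; last exact: fc.
  by apply: cvgB; [exact: cvg_id|exact: cvg_cst].
- split.
  + by move=> x _; case: (dPb x).
  + exact/cvg_at_right_filter/cPb.
  + exact/cvg_at_left_filter/cPb.
- by move=> x _; rewrite derive1E; case: (dPb x).
Qed.

Lemma is_derive_big_sum (R : realType) (I : Type) (s : seq I) (F : I -> R -> R)
    (dF : I -> R) (x : R) :
  (forall i, is_derive x 1 (F i) (dF i)) ->
  is_derive x 1 (fun y => \sum_(i <- s) F i y) (\sum_(i <- s) dF i).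
Proof.
move=> FdF; elim: s => [|i s IH].
  rewrite big_nil (_ : (fun _ => _) = cst 0); last by apply/funext => y; rewrite big_nil.
  exact: is_derive_cst.
rewrite big_cons (_ : (fun _ => _) = F i + (fun y => \sum_(i <- s) F i y)).
  exact: is_deriveD.
by apply/funext => y; rewrite big_cons.
Qed.

(** * The test set *)
Definition blocks (W : nat) : seq int := [seq i%:Z - W%:Z | i <- iota 0 (W + W)].

Lemma mem_blocks W n : (n \in blocks W) = (- W%:Z <= n < W%:Z).
Proof.
apply/mapP/idP => [[i]|nW].
  rewrite mem_iota => /andP[_ iW] ->; lia.
exists (absz (n + W%:Z)); first (rewrite mem_iota; lia); lia.
Qed.

Lemma blocks_uniq W : uniq (blocks W).
Proof. by rewrite map_inj_uniq ?iota_uniq// => i j /addIr[]. Qed.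

Definition cells (N : int -> nat) (W : nat) : seq (int * nat) :=
  [seq (n, k) | n <- blocks W, k <- iota 0 (N n)].

Lemma mem_cells N W c :
  (c \in cells N W) = (- W%:Z <= c.1 < W%:Z) && (c.2 < N c.1)%N.
Proof.
apply/allpairsPdep/idP => [[n [k [nW kN ->]]]|/andP[cW cN]].
  by rewrite -mem_blocks nW; move: kN; rewrite mem_iota.
by exists c.1, c.2; rewrite mem_blocks mem_iota cW cN; case: c {cW cN}.
Qed.

Lemma cells_uniq N W : uniq (cells N W).
Proof.
apply: allpairs_uniq_dep; first exact: blocks_uniq.
  by move=> n _; exact: iota_uniq.
by move=> [n k] [n' k'] _ _ /= [-> ->].
Qed.

Lemma sum_cells (R : realType) N W (F : int * nat -> R) :
  \sum_(c <- cells N W) F c =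
  \sum_(0 <= i < W + W) \sum_(0 <= k < N (i%:Z - W%:Z)) F (i%:Z - W%:Z, k).
Proof.
rewrite big_allpairs_dep big_map /index_iota subn0.
by apply: eq_bigr => i _; rewrite /index_iota subn0.
Qed.

Definition cell_left (R : realType) (w : R) (N : int -> nat) (c : int * nat) : R :=
  grid (c.1%:~R * w) (w / (N c.1)%:R) c.2.

Definition cell_right (R : realType) (w : R) (N : int -> nat) (phi : int -> R)
    (c : int * nat) : R :=
  cell_left w N c + phi c.1 * (w / (N c.1)%:R).

Definition test_interval (R : realType) (w : R) (N : int -> nat) (phi : int -> R)
    (c : int * nat) : set R :=
  `[cell_left w N c, cell_right w N phi c]%classic.

Definition test_set (R : realType) (w : R) (N : int -> nat) (phi : int -> R) : set R :=
  \bigcup_(c in [set c | (c.2 < N c.1)%N]) test_interval w N phi c.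

Section TestSet.
Variables (R : realType) (w : R) (N : int -> nat) (phi : int -> R).
Hypothesis w0 : 0 < w.
Hypothesis N0 : forall n, (0 < N n)%N.
Hypothesis phi01 : forall n, 0 < phi n < 1.
Let l := cell_left w N.
Let r := cell_right w N phi.
Let J := test_interval w N phi.
Let T := test_set w N phi.

Lemma cell_width_gt0 n : 0 < w / (N n)%:R.
Proof. by rewrite divr_gt0// ltr0n. Qed.

Lemma cell_left_lt_right c : l c < r c.
Proof.
rewrite /r /cell_right ltrDl mulr_gt0 ?cell_width_gt0//.
by case/andP: (phi01 c.1).
Qed.

Lemma test_interval_block c x : (c.2 < N c.1)%N -> J c x ->
  c.1%:~R * w <= x < (c.1 + 1)%:~R * w.
Proof.
move=> ck; rewrite /J /test_interval/= in_itv/= => /andP[lx xr].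
have h0 := cell_width_gt0 c.1.
apply/andP; split; first by apply: le_trans lx; rewrite lerDl mulr_ge0// ltW.
apply: (le_lt_trans xr).
apply: (@lt_le_trans _ _ (grid (c.1%:~R * w) (w / (N c.1)%:R) c.2.+1)).
  by rewrite gridS ltrD2l gtr_pMl//; case/andP: (phi01 c.1).
apply: (le_trans (le_grid _ (ltW h0) ck)).
by rewrite /grid [(N c.1)%:R * _]mulrC divfK ?pnatr_eq0 -?lt0n// intrD mulrDl mul1r.
Qed.

(** A left inverse of the indexing of the test intervals, which makes them
    disjoint: the block of [x] and the cell of [x] inside that block. *)
Definition cell_of (x : R) : int * nat :=
  let n := Num.floor (x / w) in (n, Num.truncn ((x - n%:~R * w) / (w / (N n)%:R))).

Lemma cell_of_test_interval c x : (c.2 < N c.1)%N -> J c x -> cell_of x = c.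
Proof.
move=> ck Jx; have := test_interval_block ck Jx.
case: c ck Jx => n k /= ck; rewrite /J /test_interval/= in_itv/= => /andP[lx xr] nx.
have -> : cell_of x = (n, Num.truncn ((x - n%:~R * w) / (w / (N n)%:R))).
  rewrite /cell_of (@floor_def _ _ n)//.
  by rewrite ler_pdivlMr// ltr_pdivrMr.
congr (_, _); apply: truncn_def.
have h0 := cell_width_gt0 n.
rewrite ler_pdivlMr// ltr_pdivrMr// -natr1 mulrDl mul1r.
move: lx xr; rewrite /cell_right /cell_left/= /grid => lx xr.
apply/andP; split; first by move: lx; lra.
have : phi n * (w / (N n)%:R) < w / (N n)%:R.
  by rewrite gtr_pMl//; case/andP: (phi01 n).
by move: xr; lra.
Qed.

Lemma measurable_test_set : measurable T.
Proof.
rewrite /T /test_set bigcup_mkcond; apply: countable_bigcupT_measurable.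
  exact: countableP.
by move=> c; case: ifP => _ //; exact: measurable_itv.
Qed.

Lemma test_set_locally_finite : locally_finite_union_of_intervals T.
Proof.
exists [set J c | c in [set c | (c.2 < N c.1)%N]]; split.
- move=> _ [c ck <-]; exists (l c), (r c), true, false; split => //.
  exact: cell_left_lt_right.
- move=> _ [a [b [x [y [ab ->]]]]].
  pose W := (Num.truncn ((`|a| + `|b|) / w)).+1.
  have WB : `|a| + `|b| < W%:R * w by rewrite -ltr_pdivrMr//; exact: truncnS_gt.
  move: W WB => W WB.
  apply: (@sub_finite_set _ _ [set J c | c in [set` cells N W]]); last first.
    exact/finite_image/finite_seq.
  move=> _ [[c ck <-] [z [Jz zab]]]; exists c => //=; rewrite mem_cells.
  apply/andP; split => //.
  have /andP[az zb] : a <= z <= b.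
    by case: x zab; case: y; rewrite /= in_itv/= => /andP[z1 z2];
      apply/andP; split => //; exact: ltW.
  have /andP[cz zc] := test_interval_block ck Jz.
  have nW : - (W%:R * w) < z < W%:R * w.
    have := ler_norm b; have := ler_norm (- a); rewrite normrN.
    have := normr_ge0 a; have := normr_ge0 b; move: WB az zb.
    by move=> *; apply/andP; split; lra.
  move: nW => /andP[Wz zW].
  have : (- W%:Z)%:~R * w < (c.1 + 1)%:~R * w :> R.
    by apply: lt_trans zc; rewrite intrN mulNr.
  have : c.1%:~R * w < W%:Z%:~R * w :> R by apply: le_lt_trans zW.
  by rewrite !ltr_pM2r// !ltr_int ltzD1 => -> ->.
- by rewrite bigcup_image.
Qed.

(** Only the blocks between [- W w] and [W w] meet the support of the translate,
    which leaves a finite sum of increments of a primitive. *)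
Lemma integral_test_set (f P : R -> R) (A b : R) (W : nat) :
  continuous f -> (forall x, 0 <= f x) -> (forall x, A <= `|x| -> f x = 0) ->
  (forall x : R, is_derive x 1 P (f x)) -> A + `|b| <= W%:R * w ->
  (\int[lebesgue_measure]_(x in T) (f (x - b))%:E =
   (\sum_(c <- cells N W) (P (r c - b) - P (l c - b)))%:E)%E.
Proof.
move=> fc f0 fA dP AW.
have fbc : continuous (fun x => f (x - b)).
  move=> x; apply: continuous_comp; last exact: fc.
  by apply: cvgB; [exact: cvg_id|exact: cvg_cst].
pose D := \big[setU/set0]_(c <- cells N W) J c.
have cellsk c : c \in cells N W -> (c.2 < N c.1)%N.
  by rewrite mem_cells => /andP[].
have DE : D = \bigcup_(c in [set` cells N W]) J c by rewrite bigcup_seq.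
have -> : (\int[lebesgue_measure]_(x in T) (f (x - b))%:E =
           \int[lebesgue_measure]_(x in D) (f (x - b))%:E)%E.
  rewrite integral_mkcond [RHS]integral_mkcond; apply: eq_integral => x _.
  rewrite !patchE; have [xD|xD] := boolP (x \in D).
    rewrite mem_set//; move: xD; rewrite inE DE => -[c cW Jx].
    by exists c => //=; exact: cellsk.
  case: ifPn => // /set_mem [c ck Jx]; congr EFin.
  apply: fA; rewrite leNgt; apply/negP => xbA; move/negP: xD; apply.
  rewrite inE DE; exists c => //=; rewrite mem_cells; apply/andP; split => //.
  have /andP[cx xc] := test_interval_block ck Jx.
  have /andP[Wx xW] : - (W%:R * w) < x < W%:R * w.
    rewrite -ltr_norml; apply: lt_le_trans AW.
    by rewrite -{1}[x](subrK b) (le_lt_trans (ler_normD _ _))// ltrD2r.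
  have : (- W%:Z)%:~R * w < (c.1 + 1)%:~R * w :> R.
    by apply: lt_trans xc; rewrite intrN mulNr.
  have : c.1%:~R * w < W%:Z%:~R * w :> R by apply: le_lt_trans xW.
  by rewrite !ltr_pM2r// !ltr_int ltzD1 => -> ->.
rewrite /D ge0_integral_bigsetU//.
- rewrite -sumEFin; apply: eq_bigr => c _.
  by rewrite (integral_translate _ fc dP)//; exact: cell_left_lt_right.
- by move=> c; exact: measurable_itv.
- exact: cells_uniq.
- move=> c c' /= cW c'W [x [Jx J'x]].
  by rewrite -(cell_of_test_interval (cellsk c cW) Jx)
             -(cell_of_test_interval (cellsk c' c'W) J'x).
- apply/measurable_EFinP; apply: measurable_funTS.
  exact: continuous_measurable_fun.
- by move=> x _; rewrite lee_fin.
Qed.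

End TestSet.

(** * Positivity of the derivative *)
Lemma summation_by_parts (R : realType) (u v : nat -> R) n :
  \sum_(0 <= i < n) u i * (v i - v i.+1) =
  u 0%N * v 0%N - u n * v n + \sum_(0 <= i < n) (u i.+1 - u i) * v i.+1.
Proof.
elim: n => [|n IH]; first by rewrite !big_nil subrr addr0.
by rewrite !big_nat_recr//= IH; ring.
Qed.

Lemma exists_common_lower_bound (R : realType) (d : int -> R) (n : int) (K : nat) :
  (forall m, 0 < d m) ->
  exists mu : R, 0 < mu /\ forall m, `|n - m| <= K%:Z -> mu <= d m.
Proof.
move=> d0; elim: K => [|K [mu [mu0 mud]]].
  by exists (d n); split => // m; rewrite normr_le0 subr_eq0 => /eqP ->.
exists (Num.min mu (Num.min (d (n + K.+1%:Z)) (d (n - K.+1%:Z)))); split.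
  by rewrite !lt_min mu0 !d0.
move=> m nm; rewrite !ge_min.
have [/mud -> //|Knm] := leP `|n - m| K%:Z.
have [->|->] : m = n + K.+1%:Z \/ m = n - K.+1%:Z by lia.
  by rewrite lexx orbT.
by rewrite lexx !orbT.
Qed.

(** Any strictly increasing map from the integers to (0, 1) would serve as the
    sequence of densities; this one is the logistic function. *)
Definition density (R : realType) (n : int) : R := (1 + expR (- n%:~R))^-1.

Lemma density_bounds (R : realType) n : 0 < density R n < 1.
Proof.
have e0 := expR_gt0 (- n%:~R : R).
by rewrite /density invr_gt0 invf_lt1 ltr_pwDl ?ltrDl ?(ltW e0)//= e0.
Qed.

Lemma density_lt (R : realType) m n : m < n -> density R m < density R n.
Proof.
have pos k : 0 < 1 + expR (- k%:~R : R) by rewrite ltr_pwDl// expR_ge0.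
move=> mn; rewrite /density ltf_pV2 ?posrE//.
by rewrite ltrD2l ltr_expR ltrN2 ltr_int.
Qed.

(** Up to the cell error, each interval gains the proportion [s] of the drop of
    [f] over its cell, and these drops telescope. *)
Lemma block_gain (R : realType) (f : R -> R) (p h s : R) (N : nat) :
  s * (f p - f (grid p h N)) - cell_error f p h s N <=
  \sum_(0 <= k < N) (f (grid p h k) - f (grid p h k + s * h)).
Proof.
have p0 : p = grid p h 0 by rewrite /grid mul0r addr0.
rewrite {1}p0 -[X in s * X]opprB.
rewrite -(telescope_sumr (fun k => f (grid p h k)) (leq0n N)).
rewrite mulrN mulr_sumr -opprD /cell_error -big_split/= lerNl -sumrN.
apply: ler_sum_nat => k _; rewrite opprB addrC -lerBlDr.
exact: ler_norm.
Qed.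

Lemma cell_error_eq0 (R : realType) (f : R -> R) (p h s : R) (N : nat) :
  0 <= h -> 0 <= s <= 1 -> (forall x, p <= x <= grid p h N -> f x = 0) ->
  cell_error f p h s N = 0.
Proof.
move=> h0 /andP[s0 s1] fp0; rewrite /cell_error big_nat big1// => k /andP[_ kN].
have pk j : p <= grid p h j by rewrite lerDl mulr_ge0.
have kS : grid p h k.+1 <= grid p h N by exact: le_grid.
have sh : s * h <= h by rewrite ler_piMl.
have sh0 : 0 <= s * h by rewrite mulr_ge0.
rewrite !fp0 ?subrr ?mulr0 ?subrr ?normr0 ?pk//=.
- by apply: le_grid => //; exact: ltnW.
- move: kS; rewrite gridS => kS; have := pk k.
  by move=> pk'; apply/andP; split; lra.
Qed.

(** Here [y] is the translation, all blocks that meet the translated support are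
    at distance at most [K] from block [m], and [mu n] is a lower bound
    for the increments of [phi] over the blocks at distance at most [K] from
    [n].  The weights [phi (n + 1) - phi n] in the permitted errors have a sum
    less than 1, so the errors of all blocks together stay below the gain
    [c * d] of the single block [m]. *)
Section Rate.
Variables (R : realType) (f : R -> R) (A c w y : R) (N : int -> nat).
Variables (phi mu : int -> R) (K W : nat) (m : int).
Hypothesis f0 : forall x, 0 <= f x.
Hypothesis fA : forall x, A <= `|x| -> f x = 0.
Hypothesis w0 : 0 < w.
Hypothesis c0 : 0 < c.
Hypothesis N0 : forall n, (0 < N n)%N.
Hypothesis phi01 : forall n, 0 < phi n < 1.
Hypothesis phi_lt : forall n n', n < n' -> phi n < phi n'.
Hypothesis KA : 2 * A <= K%:R * w.
Hypothesis mu_le : forall n n', `|n - n'| <= K%:Z -> mu n <= phi n' - phi (n' - 1).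
Hypothesis small : forall n p s, 0 <= s <= 1 ->
  cell_error f p (w / (N n)%:R) s (N n) <= c * (phi (n + 1) - phi n) * mu n.
Hypothesis WA : A + `|y| <= W%:R * w.
Hypothesis fm : c <= f (m%:~R * w - y).

Let d := phi m - phi (m - 1).

Let d0 : 0 < d.
Proof. by rewrite subr_gt0; apply: phi_lt; rewrite ltrBlDr ltrDl. Qed.

Let mA : `|m%:~R * w - y| < A.
Proof.
by rewrite ltNge; apply/negP => /fA fm0; move: fm; rewrite fm0 leNgt c0.
Qed.

Let grid_end n : grid (n%:~R * w - y) (w / (N n)%:R) (N n) = (n + 1)%:~R * w - y.
Proof.
rewrite /grid [(N n)%:R * _]mulrC divfK ?pnatr_eq0 -?lt0n// intrD mulrDl mul1r.
by ring.
Qed.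

Let block_error n :
  cell_error f (n%:~R * w - y) (w / (N n)%:R) (phi n) (N n) <=
  c * (phi (n + 1) - phi n) * d.
Proof.
have s01 : 0 <= phi n <= 1 by have /andP[/ltW -> /ltW ->] := phi01 n.
have t0 : 0 < phi (n + 1) - phi n by rewrite subr_gt0 phi_lt// ltrDl.
have [nm|mn] := leP `|n - m| K%:Z.
  by apply: le_trans (small n _ s01) _; rewrite ler_pM2l ?mulr_gt0// mu_le.
rewrite cell_error_eq0//; first by rewrite !mulr_ge0// ltW.
  by rewrite divr_ge0// ltW.
move=> x; rewrite grid_end intrD mulrDl mul1r => /andP[px xp]; apply: fA.
(* A block farther than K from m lies outside the translated support. *)
have far : (K%:R + 1) * w <= `|n%:~R * w - m%:~R * w|.
  rewrite -mulrBl normrM (gtr0_norm w0) ler_pM2r// -intrB -intr_norm.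
  by rewrite -[K%:R + 1]/(K%:~R + 1%:~R) -intrD ler_int lezD1.
have -> : x = (n%:~R * w - m%:~R * w) + (m%:~R * w - y) + (x - (n%:~R * w - y)).
  by ring.
have mA' := mA.
set X := n%:~R * w - m%:~R * w in far *; set Y := m%:~R * w - y in mA' *.
set Z := x - _.
have Z0 : `|Z| <= w by rewrite ger0_norm /Z; lra.
have : `|X| <= `|X + Y + Z| + `|Y| + `|Z|.
  rewrite {1}(_ : X = (X + Y + Z) - Y - Z); last by ring.
  by apply: le_trans (ler_normB _ _) _; rewrite lerD2r ler_normB.
by move: Z0 far mA' KA; lra.
Qed.

Lemma rate_gt0 :
  0 < \sum_(e <- cells N W) (f (cell_left w N e - y) - f (cell_right w N phi e - y)).
Proof.
pose n i := i%:Z - W%:Z.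
pose u i := phi (n i).
pose v i := f ((n i)%:~R * w - y).
have nS i : n i.+1 = n i + 1 by rewrite /n; lia.
have block i : u i * (v i - v i.+1) - c * (u i.+1 - u i) * d <=
    \sum_(0 <= k < N (n i)) (f (cell_left w N (n i, k) - y) -
                             f (cell_right w N phi (n i, k) - y)).
  have := block_gain f ((n i)%:~R * w - y) (w / (N (n i))%:R) (u i) (N (n i)).
  rewrite grid_end -/(v i) -nS -/(v i.+1) => /(le_trans _) gain.
  rewrite [leRHS](_ : _ = \sum_(0 <= k < N (n i))
    (f (grid ((n i)%:~R * w - y) (w / (N (n i))%:R) k) -
     f (grid ((n i)%:~R * w - y) (w / (N (n i))%:R) k + u i * (w / (N (n i))%:R)))).
    by apply: gain; rewrite lerD2l lerN2 /u nS block_error.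
  apply: eq_bigr => k _; rewrite /cell_right /cell_left /grid/=.
  by congr (f _ - f _); rewrite -/(u i); ring.
rewrite sum_cells; apply: lt_le_trans (ler_sum_nat (fun i _ => block i)).
rewrite sumrB summation_by_parts -mulr_suml -mulr_sumr telescope_sumr//.
have Wy : 0 <= `|y| by [].
have v0 : v 0%N = 0.
  apply: fA; rewrite /n sub0r intrN mulNr -opprD normrN.
  have := ler_norm (W%:R * w + y); have := ler_norm (- y); rewrite normrN.
  by rewrite -[W%:~R]/(W%:R); move: WA; lra.
have vW : v (W + W)%N = 0.
  apply: fA; rewrite /n PoszD addrK.
  have := ler_norm (W%:R * w - y); have := ler_norm y.
  by rewrite -[W%:~R]/(W%:R); move: WA; lra.
rewrite v0 vW !mulr0 subrr add0r subr_gt0.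
have u01 : u (W + W)%N - u 0%N < 1.
  have /andP[_ +] := phi01 (n (W + W)%N); have /andP[+ _] := phi01 (n 0%N).
  by rewrite /u; lra.
apply: (@lt_le_trans _ _ (c * d)).
  by rewrite mulrAC gtr_pMr// mulr_gt0.
have [j jW nj] : exists2 j, (j < W + W)%N & n j.+1 = m.
  have : - (W%:R * w) < m%:~R * w < W%:R * w.
    move: mA WA; rewrite ltr_norml => /andP[].
    have := ler_norm y; have := ler_norm (- y); rewrite normrN.
    by move=> *; apply/andP; split; lra.
  rewrite -mulNr !ltr_pM2r// -[W%:R]/(W%:~R) -intrN !ltr_int => /andP[Wm mW].
  by exists (absz (m + W%:Z - 1)%R); rewrite /n; move: Wm mW; clear; lia.
rewrite big_mkord (bigD1 (Ordinal jW))//=.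
apply: (@le_trans _ _ ((u j.+1 - u j) * v j.+1)).
  rewrite /u /v nj (_ : n j = m - 1); last by rewrite -nj nS addrK.
  by rewrite mulrC ler_pM2l.
rewrite lerDl; apply: sumr_ge0 => i _; apply: mulr_ge0; last exact: f0.
by rewrite subr_ge0 ltW// /u nS phi_lt// ltrDl.
Qed.

End Rate.

(** * Strict monotonicity *)
Lemma lt_of_pos_derivative (R : realType) (F dF : R -> R) (b b' : R) :
  b < b' -> (forall y : R, is_derive y 1 F (dF y)) ->
  (forall y, b < y < b' -> 0 < dF y) -> F b < F b'.
Proof.
move=> bb' FdF dF0.
have cF : {within `[b, b'], continuous F}.
  apply: continuous_subspaceT => y; apply/differentiable_continuous/derivable1_diffP.
  by case: (FdF y).
have [y yb] := MVT bb' (fun y _ => FdF y) cF.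
by move=> E; rewrite -subr_gt0 E mulr_gt0 ?subr_gt0// dF0//; move: yb; rewrite in_itv.
Qed.

Lemma is_derive_reflect (R : realType) (f P : R -> R) (a y : R) :
  (forall x : R, is_derive x 1 P (f x)) ->
  is_derive y 1 (fun y => P (a - y)) (- f (a - y)).
Proof.
move=> dP; rewrite -mulrN1; apply: (@is_derive1_comp _ P (fun y => a - y)).
by apply: is_derive_eq; rewrite add0r mul1r.
Qed.

Theorem theorem3p7 (R : realType) (f : R -> R)
    (f_ge0 : forall x, 0 <= f x)
    (f_neq0 : exists x, f x != 0)
    (f_supp : compactly_supported f)
    (f_ac : abs_continuous f) :
  exists T : set R,
    [/\ measurable T,
        forall b b' : R, b != b' ->
          (\int[lebesgue_measure]_(x in T) (f (x - b)%R)%:E <>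
           \int[lebesgue_measure]_(x in T) (f (x - b')%R)%:E)%E,
        locally_finite_union_of_intervals T &
        forall b b' : R, b < b' ->
          (\int[lebesgue_measure]_(x in T) (f (x - b)%R)%:E <
           \int[lebesgue_measure]_(x in T) (f (x - b')%R)%:E)%E].
Proof.
have fc := abs_continuous_continuous f_ac.
have [A A0 fA] := compactly_supported_bounded f_supp.
have [P dP] := primitive_exists fc A0 fA.
have [x0 fx0] := f_neq0.
have c0 : 0 < f x0 / 2 by rewrite divr_gt0// lt0r fx0 f_ge0.
have [w w0 fw] := abs_continuous_uniformly f_ac c0.
set c := f x0 / 2 in c0 fw.
have near_x0 x : `|x - x0| < w -> c <= f x.
  by move=> /fw; rewrite ltr_norml => /andP[+ _]; rewrite /c; lra.
pose K := (Num.truncn (2 * A / w)).+1.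
have KA : 2 * A <= K%:R * w.
  by rewrite -ler_pdivrMr// ltW//; exact: truncnS_gt.
pose phi := density R.
have phi_gt n : 0 < phi n - phi (n - 1).
  by rewrite subr_gt0 density_lt// ltrBlDr ltrDl.
have [mu mu_prop] := choice (fun n => exists_common_lower_bound n K phi_gt).
have eps0 n : 0 < c * (phi (n + 1) - phi n) * mu n.
  apply: mulr_gt0; last by case: (mu_prop n).
  by apply: mulr_gt0 => //; rewrite subr_gt0 density_lt// ltrDl.
have fl x : x <= - A -> f x = 0.
  by move=> xA; apply: fA; rewrite -normrN; apply: le_trans (ler_norm _); rewrite lerNr.
have fr x : A <= x -> f x = 0.
  by move=> xA; apply: fA; apply: le_trans (ler_norm _).
have AA : - A < A by lra.
have [N N_prop] := choice (fun n =>
  small_cell_error f_ac AA fl fr w0 (eps0 n)).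
have N0 n : (0 < N n)%N by case: (N_prop n).
have phi01 n : 0 < phi n < 1 by exact: density_bounds.
have incr b b' : b < b' ->
    (\int[lebesgue_measure]_(x in test_set w N phi) (f (x - b)%R)%:E <
     \int[lebesgue_measure]_(x in test_set w N phi) (f (x - b')%R)%:E)%E.
  move=> bb'.
  pose W := (Num.truncn ((A + `|b| + `|b'|) / w)).+1.
  have WA : A + `|b| + `|b'| <= W%:R * w.
    by rewrite -ler_pdivrMr// ltW//; exact: truncnS_gt.
  have b0 := normr_ge0 b; have b'0 := normr_ge0 b'.
  rewrite !(@integral_test_set _ w N phi w0 N0 phi01 f P A _ W)//; [|lra|lra].
  rewrite lte_fin.
  apply: (lt_of_pos_derivative
    (F := fun y => \sum_(e <- cells N W)
       (P (cell_right w N phi e - y) - P (cell_left w N e - y)))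
    (dF := fun y => \sum_(e <- cells N W)
       (f (cell_left w N e - y) - f (cell_right w N phi e - y))) bb').
    move=> y; apply: is_derive_big_sum => e.
    rewrite [f _ - f _](_ : _ = - f (cell_right w N phi e - y) -
      - f (cell_left w N e - y)); last by rewrite opprK addrC.
    exact: is_deriveB (is_derive_reflect _ _ dP) (is_derive_reflect _ _ dP).
  move=> y /andP[yb yb'].
  (* The point m w - y of the translated grid lies in (x0 - w, x0]. *)
  pose m := Num.floor ((x0 + y) / w).
  have /andP[m1 m2] := floor_itv ((x0 + y) / w).
  rewrite ler_pdivlMr// in m1; rewrite ltr_pdivrMr// intrD mulrDl mul1r in m2.
  apply: (@rate_gt0 _ f A c w y N phi mu K W m) => //.
  - by move=> n n'; exact: density_lt.
  - by move=> n n'; case: (mu_prop n) => _; apply.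
  - by move=> n p s; case: (N_prop n) => _; apply.
  - suff : `|y| <= `|b| + `|b'| by lra.
    have := ler_norm b'; have := ler_norm (- b); rewrite normrN => ? ?.
    by rewrite ler_norml; apply/andP; split; lra.
  - by apply: near_x0; rewrite ltr_norml; apply/andP; split; rewrite /m; lra.
exists (test_set w N phi); split => //.
- exact: measurable_test_set.
- move=> b b' /lt_total/orP[] /incr; first by move=> + E; rewrite E ltxx.
  by move=> + E; rewrite E ltxx.
- exact: test_set_locally_finite.
Qed.
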